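(* For any positive integer $k$ there exists a positive integer $d(k)$ such that the following holds: if $T$ is a tournament with minimum out-degree $\delta^+(T) \ge d(k)$, then $T$ contains a subdivision of $\overrightarrow{K}_k$.
   Context: A tournament is a (finite) directed graph in which, for every pair of distinct vertices $x,y$, exactly one of the directed edges $xy$, $yx$ is present. The complete directed graph $\overrightarrow{K}_k$ is the directed graph on $k$ vertices in which, for every pair $x,y$ of distinct vertices, both directed edges $xy$ and $yx$ are present. A subdivision of $\overrightarrow{K}_k$ in $T$ consists of a set $U$ of $k$ distinct vertices of $T$ (branch vertices) together with, for each ordered pair $(u,v)$ of distinct vertices of $U$, a directed path $P_{uv}$ in $T$ from $u$ to $v$ (of length at least $1$), such that the interior vertices of each path are not in $U$ and no interior vertex of one of these paths lies on another of these paths. $\delta^+(T)$ denotes the minimum out-degree of $T$. *)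

(* Defs.v *)
From mathcomp Require Import all_boot.

Set Implicit Arguments.
Unset Strict Implicit.
Unset Printing Implicit Defensive.

Definition tournament (T : finType) (e : rel T) : Prop :=
  irreflexive e /\ forall x y : T, x != y -> e x y (+) e y x.

Definition outdeg (T : finType) (e : rel T) (x : T) : nat := #|[set y | e x y]|.

(* Every out-degree is at most #|T|, so the neutral element #|T| does not affect
   the minimum when T is nonempty; on the empty vertex set the value is 0. *)
Definition min_outdeg (T : finType) (e : rel T) : nat :=
  \big[minn/#|T|]_(x : T) outdeg e x.

(* A path from u to v is given by the sequence s of its interior vertices;
   its length is size s + 1, and its vertices are u :: rcons s v. *)
Definition dipath (T : finType) (e : rel T) (u v : T) (s : seq T) : bool :=
  path e u (rcons s v) && uniq (u :: rcons s v).

(* P u v is the interior of the path from u to v. *)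
Definition is_complete_subdivision (T : finType) (e : rel T)
    (U : {set T}) (P : T -> T -> seq T) : Prop :=
  [/\ forall u v, u \in U -> v \in U -> u != v -> dipath e u v (P u v),
      forall u v x, u \in U -> v \in U -> u != v -> x \in P u v -> x \notin U
    & forall u v u' v' x,
        u \in U -> v \in U -> u != v ->
        u' \in U -> v' \in U -> u' != v' ->
        (u, v) != (u', v') ->
        x \in P u v -> x \notin u' :: rcons (P u' v') v'].

Definition contains_complete_subdivision (T : finType) (e : rel T) (k : nat) : Prop :=
  exists (U : {set T}) (P : T -> T -> seq T),
    #|U| = k /\ is_complete_subdivision e U P.

(* Main.v *)
Require Import Defs.
From mathcomp Require Import all_boot.
From mathcomp Require Import zify.

(** Remove vertices one at a time, always one of minimum out-degree in what
    remains; the k removed vertices are the branch vertices. Such a vertex v, of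
    minimum out-degree D when chosen, can be reached by a path of length at most 3
    from any x while avoiding any small set F. Otherwise the set Y of out-neighbours
    of x outside F, and all out-neighbours of Y outside F, lie in the
    out-neighbourhood O of v; but |O| <= D while |Y| is nearly D, so a vertex of Y
    beating at most half of Y has out-degree about D/2, which is too small. Hence
    the k(k-1) paths, each with at most 3 interior vertices, can be chosen greedily. *)

Lemma min_outdeg_le (T : finType) (e : rel T) (x : T) :
  min_outdeg e <= outdeg e x.
Proof.
rewrite /min_outdeg; have := mem_index_enum x.
elim: (index_enum T) => [//|y r IHr]; rewrite big_cons inE geq_min.
by case: eqP => [-> _|_ /= /IHr ->]; rewrite ?leqnn ?orbT.
Qed.

Lemma min_outdeg_le_card (T : finType) (e : rel T) : min_outdeg e <= #|T|.
Proof.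
by apply: (big_ind (fun m => m <= #|T|)) => // [m n mT nT|x _];
  rewrite ?geq_min ?mT // max_card.
Qed.

Section Tournament.

Variables (T : finType) (e : rel T).
Hypothesis eT : tournament e.

Local Notation out x := [set y | e x y].

Lemma tournament_asym x y : e x y -> e y x -> false.
Proof.
case: eT => irr tot xy yx; have [xEy|/tot] := eqVneq x y.
  by rewrite xEy irr in xy.
by rewrite xy yx.
Qed.

Lemma tournament_total x y : x != y -> ~~ e x y -> e y x.
Proof. by case: eT => _ tot /tot; case: (e x y). Qed.

(** Averaging: [e y z + e z y <= 1] for all [y], [z], so exchanging the order of summation in one of
    two copies bounds twice the number of edges inside [Y] by [#|Y| ^ 2]. *)
Lemma exists_half_outdeg (Y : {set T}) :
  Y != set0 -> exists2 y, y \in Y & #|out y :&: Y|.*2 <= #|Y|.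
Proof.
move=> Yn0; apply/exists_inP; apply: contraT; rewrite negb_exists_in.
move=> /forall_inP big_out.
have outE y : #|out y :&: Y| = \sum_(z in Y) e y z.
  rewrite -sum1_card big_mkcond [RHS]big_mkcond /=.
  by apply: eq_bigr => z _; rewrite !inE; case: (e y z); case: (z \in Y).
have: \sum_(y in Y) #|out y :&: Y|.*2 <= \sum_(y in Y) #|Y|.
  under eq_bigr => y _ do rewrite -addnn {1}outE outE.
  rewrite big_split /= [X in _ + X]exchange_big -big_split /=.
  apply: leq_sum => y _; rewrite -big_split -sum1_card; apply: leq_sum => z _ /=.
  by have := @tournament_asym y z; case: (e y z); case: (e z y) => // /(_ isT isT).
rewrite leqNgt => /negP[]; case/set0Pn: Yn0 => y0 Yy0.
rewrite (bigD1 y0) // [ltnRHS](bigD1 y0) //= -addSn leq_add //.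
  by rewrite ltnNge big_out.
by apply: leq_sum => y /andP[Yy _]; rewrite ltnW // ltnNge big_out.
Qed.

(** [R] stands for the vertices removed before [v] was chosen, [F] for all vertices a new path must
    avoid. Replacing [R] by [F] changes an out-degree by at most [#|F|]. *)
Lemma short_path_to_min_outdeg (R F : {set T}) (d : nat) (v x : T) :
    R \subset F -> v \in F -> x \notin F ->
    (forall y, y \notin R -> #|out v :\: R| <= #|out y :\: R|) ->
    (forall y, d <= outdeg e y) -> 4 * #|F| < d ->
  exists s, [/\ size s <= 2, path e x (rcons s v), uniq (x :: s)
              & {in s, forall y, y \notin F}].
Proof.
move=> RF Fv Fx vmin dmin dF; have [irr _] := eT.
have FNv y : y \notin F -> y != v by apply: contraNneq => ->.
have [xv|xNv] := boolP (e x v); first by exists [::]; rewrite /= xv.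
have vx : e v x by apply: tournament_total => //; apply: FNv.
have card_out y : y \notin F -> #|out v :\: R| <= #|out y :\: F| + #|F|.
  move=> Fy; have Ry : y \notin R by apply: contra Fy; apply: (subsetP RF).
  apply: leq_trans (vmin y Ry) _; rewrite (cardsD _ R) (cardsD _ F).
  have := subset_leq_card (subsetIr (out y) F); lia.
have dv : d <= #|out v :\: R| + #|F|.
  have := dmin v; rewrite /outdeg cardsD.
  have := subset_leq_card (subsetIr (out v) R); have := subset_leq_card RF; lia.
have [/exists_inP[y]|] := boolP [exists y in out x :\: F, e y v].
  rewrite !inE => /andP[Fy xy] yv; exists [:: y] => /=; split=> //.
  - by rewrite xy yv.
  - by rewrite inE andbT; apply/eqP => xEy; rewrite xEy irr in xy.
  - by move=> z; rewrite inE => /eqP->.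
rewrite negb_exists_in => /forall_inP YNv.
have YO : out x :\: F \subset out v :\: R.
  apply/subsetP=> y Yy; have := YNv y Yy; move: Yy; rewrite !inE => /andP[Fy _] yNv.
  rewrite (contra ((subsetP RF) y)) //=.
  by apply: tournament_total => //; apply: FNv.
(* Write [O] for [out v :\: R] and [Y] for [out x :\: F]. Then [#|Y| >= #|O| - #|F| >= d - 2 * #|F|
   > 2 * #|F|]; in particular [Y] is nonempty. *)
have Yx := card_out x Fx.
have [y Yy half] : exists2 y, y \in out x :\: F
    & #|out y :&: (out x :\: F)|.*2 <= #|out x :\: F|.
  by apply: exists_half_outdeg; rewrite -card_gt0; lia.
have Fy : y \notin F by move: Yy; rewrite inE => /andP[].
have xy : e x y by move: Yy; rewrite !inE => /andP[].
have yNv := YNv y Yy.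
have [/subsetP yO|] := boolP (out y :\: F \subset out v :\: R).
  (* This case is impossible: it gives [#|O| - #|F| <= #|Y| / 2 + #|O| - #|Y|], hence
     [#|Y| <= 2 * #|F|]. The factor 4 in the hypothesis comes from here. *)
  have: #|out y :\: F| <= #|out y :&: (out x :\: F)| + #|(out v :\: R) :\: (out x :\: F)|.
    apply: leq_trans (leq_card_setU _ _); apply: subset_leq_card.
    apply/subsetP => z yz; have := yO z yz; move: yz; rewrite !inE.
    by case: (z \in F) => //=; case: (e x z); case: (e y z);
      case: (z \in R); rewrite ?orbT.
  have Yy' := card_out y Fy; have := subset_leq_card YO.
  rewrite (cardsDS YO); lia.
case/subsetPn => z; rewrite !inE => /andP[Fz yz].
rewrite (contra ((subsetP RF) z)) //= => vNz.
exists [:: y; z]; split=> //=.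
- by rewrite xy yz tournament_total // eq_sym FNv.
- rewrite !inE andbT negb_or; apply/andP; split; last first.
    by apply/eqP => yEz; rewrite yEz irr in yz.
  apply/andP; split; first by apply/eqP => xEy; rewrite xEy irr in xy.
  (* [x] and [z] differ because [v] beats [x] but not [z]. *)
  by apply: contraNneq vNz => <-.
- by move=> t; rewrite !inE => /orP[] /eqP->.
Qed.

(** [R] is the set of vertices chosen before [v]. The order of choice is forgotten: [R \subset U]
    suffices, as every path will avoid all of [U] in its interior. *)
Lemma exists_successive_min_outdeg (k : nat) :
    k <= #|T| ->
  exists2 U : {set T}, #|U| = k & forall v, v \in U ->
    exists2 R : {set T}, R \subset U
      & forall y, y \notin R -> #|out v :\: R| <= #|out y :\: R|.
Proof.
elim: k => [|k IHk] kT; first by exists set0 => [|v]; rewrite ?cards0 ?inE.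
have [U cardU minU] := IHk (ltnW kT).
have [x0 Ux0] : exists x, x \in ~: U.
  by apply/set0Pn; rewrite -card_gt0; have := cardsC U; lia.
case: (arg_minnP (fun v => #|out v :\: U|) Ux0) => v; 
  rewrite -[_ v]/(v \in ~: U) inE => Uv vmin.
exists (v |: U) => [|w]; first by rewrite cardsU1 cardU Uv.
rewrite !inE => /predU1P[->|/minU[R RU wmin]].
  by exists U => [|y Uy]; [apply: subsetUr | apply: vmin; apply/setCP/negP].
by exists R => //; apply: subset_trans RU (subsetUr _ _).
Qed.

(** Induction on [L], the path of the head being added last. The bound on the total interior size is
    carried along to keep the forbidden set [F] small. *)
Lemma greedy_paths (U : {set T}) (d : nat) (L : seq (T * T)) :
    (forall v, v \in U -> exists2 R : {set T}, R \subset U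
      & forall y, y \notin R -> #|out v :\: R| <= #|out y :\: R|) ->
    (forall y, d <= outdeg e y) -> 4 * (#|U| + 3 * size L) < d ->
    {in L, forall p, [/\ p.1 \in U, p.2 \in U & p.1 != p.2]} -> uniq L ->
  exists f : T * T -> seq T,
    [/\ size (flatten (map f L)) <= 3 * size L,
        {in L, forall p, dipath e p.1 p.2 (f p)},
        {in L, forall p, {in f p, forall x, x \notin U}}
      & {in L &, forall p q, p != q -> {in f p, forall x, x \notin f q}}].
Proof.
move=> minU dmin; elim: L => [|[u v] L IHL] /=; first by exists (fun=> [::]).
move=> dL LU /andP[uvL uniqL].
have [|p Lp||f [fsize fpath fU fdisj]] := IHL => //; first lia.
  by apply: LU; rewrite inE Lp orbT.
have [/= Uu Uv uNv] := LU (u, v) (mem_head _ _).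
pose F := U :|: [set x in flatten (map f L)].
have cardF : #|F| <= #|U| + 3 * size L.
  apply: leq_trans (leq_card_setU _ _) _; rewrite leq_add2l.
  by apply: leq_trans fsize; rewrite cardsE card_size.
have FU x : x \notin F -> x \notin U by rewrite inE negb_or => /andP[].
have Ff p x : p \in L -> x \notin F -> x \notin f p.
  move=> Lp; apply: contra => fx; rewrite !inE; apply/orP; right.
  by apply/flattenP; exists (f p) => //; apply: map_f.
(* Since [u] lies in [F], the path first steps to an out-neighbour [x] outside [F]; its interior is
   then [x :: s], of size at most 3. *)
have [x] : exists x, x \in out u :\: F.
  apply/set0Pn; rewrite -card_gt0 cardsD.
  have := subset_leq_card (subsetIr (out u) F); have := dmin u; rewrite /outdeg; lia.
rewrite in_setD in_set => /andP[Fx ux].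
have [R RU vmin] := minU v Uv.
have RF : R \subset F by apply: subset_trans RU (subsetUl _ _).
have Fv : v \in F by rewrite inE Uv.
have dF : 4 * #|F| < d by lia.
have [s [ssize spath suniq sF]] :=
  short_path_to_min_outdeg _ _ _ _ _ RF Fv Fx vmin dmin dF.
have xsF y : y \in x :: s -> y \notin F by rewrite inE => /predU1P[->//|/sF].
have fupd p : p \in L -> (if p == (u, v) then x :: s else f p) = f p.
  by move=> Lp; case: eqP => // pE; rewrite -pE Lp in uvL.
exists (fun p => if p == (u, v) then x :: s else f p).
have -> : [seq (if p == (u, v) then x :: s else f p) | p <- L] = map f L.
  by apply/eq_in_map => p /fupd.
rewrite eqxx; split.
- by rewrite /= size_cat; lia.
- move=> p; rewrite inE => /predU1P[->|Lp]; last by rewrite fupd //; apply: fpath.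
  rewrite eqxx /dipath cons_uniq rcons_uniq suniq mem_rcons inE negb_or uNv andbT.
  rewrite /= ux spath /=.
  by apply/andP; split; apply/negP => /xsF/FU; rewrite ?Uu ?Uv.
- move=> p; rewrite inE => /predU1P[-> y|Lp]; last by rewrite fupd //; apply: fU.
  by rewrite eqxx => /xsF/FU.
- move=> p q; rewrite !inE => /predU1P[->|Lp] /predU1P[->|Lq].
  + by rewrite eqxx.
  + by move=> _ y; rewrite eqxx fupd // => /xsF; apply: Ff.
  + move=> _ y; rewrite eqxx fupd // => fy; apply/negP => /xsF.
    by move/(Ff _ _ Lp); rewrite fy.
  + by rewrite !fupd //; apply: fdisj.
Qed.

End Tournament.

Theorem theorem1p2 :
  forall k : nat, 0 < k ->
  exists d : nat, 0 < d /\
    forall (T : finType) (e : rel T),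
      tournament e -> d <= min_outdeg e -> contains_complete_subdivision e k.
Proof.
(* There are [k] branch vertices and at most [k * k] ordered pairs, each using at most 3 interior
   vertices. *)
move=> k _; exists (4 * (k + 3 * (k * k))).+1; split=> // T e eT dmin.
have [|U cardU minU] := @exists_successive_min_outdeg T e k.
  by have := min_outdeg_le_card T e; lia.
pose L := enum [set p in setX U U | p.1 != p.2].
have LE p : (p \in L) = [&& p.1 \in U, p.2 \in U & p.1 != p.2].
  by rewrite mem_enum !inE andbA.
have sizeL : size L <= k * k.
  rewrite -cardE -{1 2}cardU -cardsX; apply: subset_leq_card.
  by apply/subsetP => p; rewrite inE => /andP[].
have [y||p||f [_ fpath fU fdisj]] :=
  @greedy_paths T e eT U (4 * (k + 3 * (k * k))).+1 L minU.
- exact: leq_trans dmin (min_outdeg_le T e y).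
- by rewrite cardU ltnS leq_mul2l leq_add2l leq_mul2l sizeL.
- by rewrite LE => /and3P.
- exact: enum_uniq.
have inL u v : u \in U -> v \in U -> u != v -> (u, v) \in L.
  by move=> Uu Uv uNv; rewrite LE Uu Uv.
exists U, (fun u v => f (u, v)); split=> //; split.
- by move=> u v Uu Uv uNv; apply: (fpath (u, v)); apply: inL.
- by move=> u v x Uu Uv uNv; apply: fU; apply: inL.
- move=> u v u' v' x Uu Uv uNv Uu' Uv' u'Nv' pNq fx.
  have xU : x \notin U := fU _ (inL _ _ Uu Uv uNv) x fx.
  have xf : x \notin f (u', v').
    exact: fdisj (inL _ _ Uu Uv uNv) (inL _ _ Uu' Uv' u'Nv') pNq x fx.
  rewrite inE mem_rcons inE !negb_or xf andbT.
  by apply/andP; split; apply: contraNneq xU => ->.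
Qed.
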